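(* Let $\mathcal{P}$ be a polytope in a Euclidean space with at least two vertices. Then its pyramidal width equals its affine pyramidal width: $$\delta_{\mathcal{P}} = \bar{\delta}_{\mathcal{P}}.$$
   Context: A polytope is the convex hull of a finite set of points. For a polytope $\mathcal{P}$, $\mathcal{V}_{\mathcal{P}}$ is its set of vertices, and a face of $\mathcal{P}$ is proper if it is neither $\emptyset$ nor $\mathcal{P}$ itself; $\mathsf{faces}^*(\mathcal{P})$ is the set of proper faces. $\mathrm{aff}(f)$ denotes the affine hull of $f$, $\|\cdot\|$ is the Euclidean norm, and $\mathsf{dist}(A,B)$ is the minimum of $\|x-y\|$ over $x\in A$, $y\in B$. The pyramidal width of $\mathcal{P}$ is $$\delta_{\mathcal{P}} := \min_{f\in\mathsf{faces}^*(\mathcal{P})} \mathsf{dist}\big(f,\ \mathrm{conv}(\mathcal{V}_{\mathcal{P}}\setminus f)\big),$$ and the affine pyramidal width of $\mathcal{P}$ is $$\bar{\delta}_{\mathcal{P}} := \min_{f\in\mathsf{faces}^*(\mathcal{P})} \mathsf{dist}\big(\mathrm{aff}(f),\ \mathrm{conv}(\mathcal{V}_{\mathcal{P}}\setminus f)\big).$$ *)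

(* Defs.v *)
From mathcomp Require Import all_boot all_order all_algebra.
From mathcomp Require Import boolp classical_sets functions cardinality reals.

Set Implicit Arguments.
Unset Strict Implicit.
Unset Printing Implicit Defensive.

Import Order.TTheory GRing.Theory Num.Theory.

Local Open Scope classical_set_scope.
Local Open Scope ring_scope.

Section Hulls.
Variables (R : realType) (E : lmodType R).
Implicit Types A : set E.

Definition conv_hull A : set E :=
  [set x | exists k (a : 'I_k -> E) (w : 'I_k -> R),
    [/\ forall i, A (a i), forall i, 0 <= w i,
        \sum_i w i = 1 & x = \sum_i w i *: a i]].

Definition aff_hull A : set E :=
  [set x | exists k (a : 'I_k -> E) (w : 'I_k -> R),
    [/\ forall i, A (a i), \sum_i w i = 1 & x = \sum_i w i *: a i]].

Definition polytope A : Prop :=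
  exists2 S : set E, finite_set S & A = conv_hull S.

End Hulls.

Section PyramidalWidth.
Variables (R : realType) (n : nat).
Local Notation E := 'rV[R]_n.
Implicit Types (u v x y c : E) (A B P f : set E).

Definition dot u v : R := \sum_i u 0 i * v 0 i.

(* The library norm on 'rV[R]_n is the sup norm, hence a separate definition. *)
Definition enorm u : R := Num.sqrt (dot u u).

(* c = 0 is allowed, so the empty set (b = 1) and P itself (b = 0) are faces. *)
Definition face P f : Prop :=
  exists c b, (forall x, P x -> dot c x <= b) /\
              f = P `&` [set x | dot c x = b].

Definition proper_face P f : Prop := [/\ face P f, f <> set0 & f <> P].

Definition vertices P : set E := [set v | face P [set v]].

(* The least element of S; the value 0 when there is none is a dummy. For a
   polytope with at least two vertices, all the minima below are attained:
   there are finitely many proper faces and at least one, a proper face misses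
   some vertex, and the distances are between a compact and a closed set. *)
Definition minimum (S : set R) : R := xget 0 (S `&` lbound S).

Definition dist A B : R :=
  minimum [set enorm (x - y) | x in A & y in B].

Definition pyramidal_width P : R :=
  minimum [set dist f (conv_hull (vertices P `\` f)) | f in proper_face P].

Definition affine_pyramidal_width P : R :=
  minimum [set dist (aff_hull f) (conv_hull (vertices P `\` f))
          | f in proper_face P].

End PyramidalWidth.

(* Main.v *)
Require Import Defs.
From mathcomp Require Import all_boot all_order all_algebra.
From mathcomp Require Import boolp classical_sets functions cardinality reals.
From mathcomp Require Import lra.

(** Since a face f lies in its affine hull, every distance to aff(f) is at most
    the distance to f, so the affine pyramidal width is at most the pyramidal
    width. For the converse, each proper face f is shown to have a companion
    proper face g with
      dist(g, conv(V \ g)) <= dist(aff(f), conv(V \ f)),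
    where V is the vertex set ([closer_proper_face]).

    Let x in aff(f) and y in conv(V \ f) be nearest points and m = x - y; m is
    nonzero, because the hyperplane cutting out f contains aff(f) and strictly
    misses V \ f. By optimality, the functional <m, .> equals <m, x> on aff(f)
    and is at most <m, y> on V \ f. Let V' be the set of vertices on which it
    is at least <m, y>, that is, f's vertices and those of V \ f that may carry
    y. Every difference d between a point of P and a point of conv(V') then
    satisfies <m, d> <= <m, m>. Travel from 0 in the direction m inside the
    polytope of these differences, as far as possible, up to l m with
    0 <= l <= 1 ([ray_exit]). Write l m = p - q with p in P and q in conv(V').
    Because the ray leaves a polyhedron there, Farkas' lemma gives a functional
    c with <c, m> > 0 which is maximal on the differences at l m. So c is
    maximal over P at p and minimal over conv(V') at q. If l were 0 then c would
    be constant on V', hence equal at x and y, which lie in its affine hull,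
    contradicting <c, x - y> > 0. So l > 0 and <c, q> < <c, p>: the face g of P
    where c is maximal contains p, while q is a convex combination of vertices
    outside g. Finally ||p - q|| = l ||m|| <= ||m||.

    The existence of nearest points, of the exit point of the ray, and Farkas'
    lemma all come from one fact, proved algebraically: a linear image of a
    nonempty set of the form {u | u A = a, u_i >= 0 for i in I} has an element
    of least norm ([least_norm]). The same tools give the facts on polytopes
    behind the definitions: a polytope is the hull of its finitely many exposed
    points ([polytope_vertices]), a face is the hull of the vertices in it
    ([face_conv]), so there are finitely many faces, and all the minima are
    attained. *)

Local Open Scope classical_set_scope.
Local Open Scope ring_scope.
Set Implicit Arguments.
Unset Strict Implicit.
Unset Printing Implicit Defensive.
Import Order.TTheory GRing.Theory Num.Theory.

(** * The dot product *)

Section Dot.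
Variables (R : realType) (n : nat).
Implicit Types u v w : 'rV[R]_n.

Lemma dotE u v : dot u v = (u *m v^T) 0 0.
Proof. by rewrite mxE; apply: eq_bigr => i _; rewrite mxE. Qed.

Lemma dotC u v : dot u v = dot v u.
Proof. by apply: eq_bigr => i _; rewrite mulrC. Qed.

Lemma dotDr u v w : dot u (v + w) = dot u v + dot u w.
Proof. by rewrite !dotE linearD mulmxDr mxE. Qed.

Lemma dotZr t u v : dot u (t *: v) = t * dot u v.
Proof. by rewrite !dotE linearZ -scalemxAr mxE. Qed.

Lemma dotNr u v : dot u (- v) = - dot u v.
Proof. by rewrite -scaleN1r dotZr mulN1r. Qed.

Lemma dotBr u v w : dot u (v - w) = dot u v - dot u w.
Proof. by rewrite dotDr dotNr. Qed.

Lemma dotDl u v w : dot (u + v) w = dot u w + dot v w.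
Proof. by rewrite dotC dotDr !(dotC w). Qed.

Lemma dotZl t u v : dot (t *: u) v = t * dot u v.
Proof. by rewrite dotC dotZr dotC. Qed.

Lemma dotNl u v : dot (- u) v = - dot u v.
Proof. by rewrite dotC dotNr dotC. Qed.

Lemma dotBl u v w : dot (u - v) w = dot u w - dot v w.
Proof. by rewrite dotDl dotNl. Qed.

Lemma dot0r u : dot u 0 = 0.
Proof. by rewrite dotE trmx0 mulmx0 mxE. Qed.

Lemma dot_sumr u k (w : 'I_k -> R) (a : 'I_k -> 'rV[R]_n) :
  dot u (\sum_i w i *: a i) = \sum_i w i * dot u (a i).
Proof.
by elim/big_rec2: _ => [|i x y _ <-]; rewrite ?dot0r // dotDr dotZr.
Qed.

Lemma dot_ge0 u : 0 <= dot u u.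
Proof. by apply: sumr_ge0 => i _; rewrite -expr2 sqr_ge0. Qed.

Lemma dot_eq0 u : dot u u = 0 -> u = 0.
Proof.
move=> u0; apply/rowP => j; rewrite mxE; apply/eqP.
have : (\sum_i u 0 i * u 0 i == 0) by apply/eqP.
rewrite psumr_eq0 => [|i _]; last by rewrite -expr2 sqr_ge0.
by move=> /allP/(_ j (mem_index_enum j))/=; rewrite mulf_eq0 orbb.
Qed.

Lemma dot_gt0 u : u <> 0 -> 0 < dot u u.
Proof.
by move=> u0; rewrite lt_def dot_ge0 andbT; apply/eqP => /dot_eq0.
Qed.

Lemma enorm_le u v : dot u u <= dot v v -> enorm u <= enorm v.
Proof. by move=> uv; rewrite /enorm ler_wsqrtr. Qed.

End Dot.

(** * Points of least norm and Farkas' lemma *)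

Section LeastNorm.
Variable R : realType.

(** Least squares: the normal equations are solvable because M M^T has the same
    kernel as M acting on rows, hence the same row space as M^T. *)
Lemma orthogonal_residual k n (z : 'rV[R]_n) (M : 'M[R]_(k, n)) :
  exists v : 'rV_k, forall u : 'rV_k, dot (z + v *m M) (u *m M) = 0.
Proof.
have kerMMt (v : 'rV_k) : v *m (M *m M^T) = 0 -> v *m M = 0.
  move=> v0; apply: dot_eq0.
  by rewrite dotE trmx_mul !mulmxA -(mulmxA v) v0 mul0mx mxE.
have rankMMt : \rank (M *m M^T) = \rank M.
  have kerE : (kermx (M *m M^T) <= kermx M)%MS.
    apply/rV_subP => v /sub_kermxP /kerMMt ?; exact/sub_kermxP.
  move: (mxrankS kerE); rewrite !mxrank_ker => le1.
  apply/eqP; rewrite eqn_leq mxrankM_maxl /=.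
  move: (rank_leq_row M) (rank_leq_row (M *m M^T)) le1 => A B.
  by rewrite leq_sub2lE.
have sub : (M^T <= M *m M^T)%MS.
  have [_ <-] := mxrank_leqif_sup (submxMl M M^T).
  by rewrite rankMMt mxrank_tr.
have /submxP [v Ev] : (z *m M^T <= M *m M^T)%MS := submx_trans (submxMl _ _) sub.
exists (- v) => u.
rewrite dotE trmx_mul mulmxA mulmxDl Ev !mulNmx -(mulmxA v) subrr.
by rewrite mul0mx mxE.
Qed.

Definition feasible k m (A : 'M[R]_(k, m)) (a : 'rV_m) (I : seq 'I_k) u :=
  u *m A = a /\ forall i, i \in I -> 0 <= u 0 i.

(** Induction on the sign constraints. Take a minimizer without the constraint
    on coordinate i. If it violates that constraint, then the segment from it to
    any feasible point crosses the hyperplane u_i = 0, and by convexity the norm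
    at the crossing is no larger than at the feasible point; so the constraint
    may be replaced by the equation u_i = 0. Without sign constraints this is
    orthogonal projection. *)
Lemma least_norm k m n (F : 'M[R]_(k, n)) (A : 'M[R]_(k, m)) a I :
  (exists u, feasible A a I u) ->
  exists2 u, feasible A a I u &
    forall v, feasible A a I v -> dot (u *m F) (u *m F) <= dot (v *m F) (v *m F).
Proof.
elim: I => [|i I IH] in m A a *.
  case=> u1 [u1A _]; set K := kermx A.
  have [v vP] := orthogonal_residual (u1 *m F) (K *m F).
  exists (u1 + v *m K).
    by split=> //; rewrite mulmxDl -mulmxA mulmx_ker mulmx0 addr0.
  move=> v' [v'A _]; set u := u1 + _.
  have /submxP[t tE] : (v' - u <= K)%MS.
    apply/sub_kermxP; rewrite mulmxBl v'A mulmxDl u1A -mulmxA mulmx_ker.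
    by rewrite mulmx0 addr0 subrr.
  have -> : v' = u + t *m K by rewrite -tE addrC subrK.
  have /= := vP t; rewrite mulmxA -mulmxDl -/u mulmxA => o.
  rewrite [X in _ <= dot X X]mulmxDl dotDl !dotDr (dotC _ (u *m F)) o.
  by rewrite addr0 add0r lerDl dot_ge0.
move=> [u1 [u1A u1I]].
have [|u0 [u0A u0I] u0min] := IH m A a.
  by exists u1; split=> // j jI; apply: u1I; rewrite inE jI orbT.
have [u0i|u0i] := leP 0 (u0 0 i).
  exists u0; first by split=> // j; rewrite inE => /orP[/eqP->//|/u0I].
  by move=> v [vA vI]; apply: u0min; split=> // j jI; apply: vI; rewrite inE jI orbT.
pose A' := row_mx A (delta_mx i 0 : 'cV_k).
pose a' := row_mx a (0 : 'rV[R]_1).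
have coefi (v : 'rV[R]_k) : v *m (delta_mx i 0 : 'cV_k) = (v 0 i)%:M.
  by rewrite -colE; apply/rowP => j; rewrite !ord1 !mxE mulr1n.
have feas' v : feasible A' a' I v <-> feasible A a I v /\ v 0 i = 0.
  rewrite /feasible /A' /a' mul_mx_row coefi; split.
    case=> /eq_row_mx[vA /(congr1 (fun X : 'M_1 => X 0 0))].
    by rewrite !mxE mulr1n.
  by case=> -[-> vI] ->; split=> //; rewrite raddf0.
have cross v : feasible A a (i :: I) v -> exists2 u, feasible A' a' I u &
    dot (u *m F) (u *m F) <= dot (v *m F) (v *m F).
  case=> vA vI; have vi : 0 <= v 0 i by apply: vI; rewrite inE eqxx.
  have d0 : 0 < v 0 i - u0 0 i by lra.
  pose t := v 0 i / (v 0 i - u0 0 i).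
  have t0 : 0 <= t by rewrite divr_ge0 // ltW.
  have t1 : t <= 1 by rewrite ler_pdivrMr //; lra.
  have tE : t * (v 0 i - u0 0 i) = v 0 i by rewrite divfK // gt_eqF.
  have vI' j : j \in I -> 0 <= v 0 j by move=> jI; apply: vI; rewrite inE jI orbT.
  exists (t *: u0 + (1 - t) *: v).
    apply/feas'; split; last by rewrite !mxE; lra.
    split; first by rewrite mulmxDl -!scalemxAl u0A vA -scalerDl addrC subrK scale1r.
    move=> j jI; rewrite !mxE addr_ge0 // mulr_ge0 ?u0I ?vI' //; lra.
  have u0v : dot (u0 *m F) (u0 *m F) <= dot (v *m F) (v *m F) by exact: u0min.
  have := dot_ge0 (u0 *m F - v *m F).
  rewrite mulmxDl -!scalemxAl; move: u0v.
  move: (u0 *m F) (v *m F) => x y.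
  rewrite !(dotDl, dotDr, dotZl, dotZr, dotNl, dotNr) (dotC y x).
  move: (dot x x) (dot y y) (dot x y) => xx yy xy h1 h2.
  have : 0 <= t * (1 - t) by rewrite mulr_ge0 //; lra.
  move: t t0 t1 {tE} => t t0 t1 t2; nra.
have [|u2 /feas'[[u2A u2I] u2i] u2min] := IH _ A' a'.
  by have [u ? _] := cross u1 (conj u1A u1I); exists u.
exists u2.
  by split=> // j; rewrite inE => /orP[/eqP->|/u2I//]; rewrite u2i.
by move=> v /cross[u /u2min le1 le2]; apply: le_trans le2.
Qed.

(** The form in which minimality is used: seen from the nearest point x to the
    origin, every other point y makes an obtuse angle with the origin. Otherwise
    a short step from x towards y would decrease the norm. *)
Lemma least_norm_obtuse k m n (F : 'M[R]_(k, n)) (A : 'M[R]_(k, m)) a I :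
  (exists u, feasible A a I u) ->
  exists2 u, feasible A a I u &
    forall v, feasible A a I v -> dot (u *m F) (u *m F) <= dot (u *m F) (v *m F).
Proof.
move=> /(least_norm F)[u [uA uI] umin]; exists u => // v [vA vI].
rewrite leNgt; apply/negP => lt.
set x := u *m F in lt *; set y := v *m F in lt *.
have e0 : 0 < dot x x - dot x y by rewrite subr_gt0.
have D0 := dot_ge0 (y - x); set D := dot (y - x) (y - x) in D0.
set e := _ - _ in e0.
(* Any t in (0, 1] with t D < 2 e makes x + t (y - x) shorter than x. *)
pose t := e / (D + e).
have De : 0 < D + e by lra.
have t0 : 0 < t by rewrite divr_gt0.
have tE : t * (D + e) = e by rewrite divfK // gt_eqF.
have t1 : t <= 1 by rewrite ler_pdivrMr //; lra.
have : feasible A a I ((1 - t) *: u + t *: v).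
  split; first by rewrite mulmxDl -!scalemxAl uA vA -scalerDl subrK scale1r.
  by move=> j jI; rewrite !mxE addr_ge0 // mulr_ge0 ?uI ?vI ?(ltW t0) //; lra.
move=> /umin; rewrite mulmxDl -!scalemxAl -/x -/y.
have -> : (1 - t) *: x + t *: y = x + t *: (y - x).
  by rewrite scalerBl scale1r scalerBr -addrA [- _ + _]addrC.
have xyx : dot x (y - x) = - e by rewrite dotBr /e opprB.
rewrite !(dotDl x, dotDr _ x) !dotZl !dotZr (dotC (y - x) x) xyx -/D.
have : t * (t * D) <= t * e by rewrite ler_pM2l //; nra.
have : 0 < t * e by rewrite mulr_gt0.
move: (t * (t * D)) => q; lra.
Qed.

(** The vector from r to the nearest point of the cone spanned by the rows of B
    vanishes, or its opposite separates r from the cone. The extra coordinate,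
    fixed to 1, translates the cone by - r. *)
Lemma farkas k n (B : 'M[R]_(k, n)) (r : 'rV[R]_n) :
  (exists2 u : 'rV_k, forall i, 0 <= u 0 i & r = u *m B) \/
  exists2 c : 'rV[R]_n, forall i, dot c (row i B) <= 0 & 0 < dot c r.
Proof.
pose F := col_mx B (- r); pose A : 'cV[R]_(k + 1) := col_mx 0 1%:M.
pose I := [seq lshift 1 i | i <- enum 'I_k].
have rowA (u : 'rV[R]_k) : row_mx u 1%:M *m A = 1%:M :> 'M[R]_1.
  by rewrite mul_row_col mulmx0 add0r mul1mx.
have feas (u : 'rV_k) : (forall i, 0 <= u 0 i) -> feasible A 1%:M I (row_mx u 1%:M).
  by move=> u0; split=> // _ /mapP[j _ ->]; rewrite row_mxEl.
have [|w [wA wI] wmin] := @least_norm_obtuse _ _ _ F A 1%:M I.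
  by exists (row_mx 0 1%:M); apply: feas => i; rewrite mxE.
pose u := lsubmx w.
have wE : w = row_mx u 1%:M.
  rewrite -[w]hsubmxK; congr row_mx.
  by move: wA; rewrite -[w]hsubmxK mul_row_col mulmx0 add0r mulmx1 row_mxKr.
have u0 i : 0 <= u 0 i.
  by rewrite /u mxE; apply: wI; apply: map_f; rewrite mem_enum.
have wF (v : 'rV[R]_k) : row_mx v 1%:M *m F = v *m B - r.
  by rewrite mul_row_col mul1mx.
have {}wmin (v : 'rV_k) : (forall i, 0 <= v 0 i) ->
   dot (u *m B - r) (u *m B - r) <= dot (u *m B - r) (v *m B - r).
  by move=> /feas/wmin; rewrite wE !wF.
have [uBr|uBr] := pselect (u *m B - r = 0).
  by left; exists u => //; apply/esym/eqP; rewrite -subr_eq0 uBr.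
right; exists (- (u *m B - r)) => [i|].
  have := wmin (u + delta_mx 0 i); rewrite mulmxDl -rowE addrAC.
  rewrite (dotDr _ _ (row i B)) lerDl.
  rewrite dotNl oppr_le0; apply=> j.
  by rewrite mxE [delta_mx _ _ _ _]mxE addr_ge0 ?u0 ?ler0n.
have le0 : dot (u *m B - r) (u *m B - r) <= dot (u *m B - r) (0 *m B - r).
  by apply: wmin => i; rewrite mxE.
apply: lt_le_trans (dot_gt0 uBr) (le_trans le0 _).
by rewrite mul0mx add0r dotNr dotNl.
Qed.
End LeastNorm.

(** * Convex and affine hulls of finite sets *)

Section Hull.
Variables (R : realType) (n : nat).
Local Notation E := 'rV[R]_n.
Implicit Types (A B : set E) (s U W V : seq E) (x y c m : E).

(** Both kinds of hull in one family, the boolean telling whether the weights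
    must be nonnegative: nearest points are needed for either kind. *)
Definition hull (b : bool) A : set E := if b then conv_hull A else aff_hull A.

Lemma hull_def b A x : hull b A x <-> exists k (a : 'I_k -> E) (w : 'I_k -> R),
  [/\ forall i, A (a i), b -> forall i, 0 <= w i, \sum_i w i = 1
    & x = \sum_i w i *: a i].
Proof.
case: b; split=> [[k [a [w]]]|[k [a [w]]]].
- by case=> ? ? ? ?; exists k, a, w.
- by case=> ? w0 ? ?; exists k, a, w; split=> //; apply: w0.
- by case=> ? ? ?; exists k, a, w.
- by case=> ? ? ? ?; exists k, a, w.
Qed.

Lemma hull_incr b A x : A x -> hull b A x.
Proof.
move=> Ax; apply/hull_def; exists 1%N, (fun=> x), (fun=> 1).
by split=> //; rewrite big_ord1 ?scale1r.
Qed.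

Lemma hull_mono b A B : A `<=` B -> hull b A `<=` hull b B.
Proof.
move=> AB x /hull_def[k [a [w [Aa w0 w1 ->]]]]; apply/hull_def.
by exists k, a, w; split=> // i; apply: AB.
Qed.

Lemma conv_sub_hull b A : conv_hull A `<=` hull b A.
Proof. by case: b => // x [k [a [w [? ? ? ?]]]]; exists k, a, w. Qed.

Lemma hull_nonempty b A x : hull b A x -> exists a, A a.
Proof.
move=> /hull_def[[|k] [a [w [Aa _]]]]; last by exists (a ord0).
by rewrite big_ord0 => /eqP; rewrite eq_sym oner_eq0.
Qed.

Lemma hull_dot_eq b A c v x :
  hull b A x -> (forall a, A a -> dot c a = v) -> dot c x = v.
Proof.
move=> /hull_def[k [a [w [Aa _ w1 ->]]]] Ac; rewrite dot_sumr.
under eq_bigr do rewrite Ac //.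
by rewrite -mulr_suml w1 mul1r.
Qed.

Lemma conv_hull_dot_le A c v x :
  conv_hull A x -> (forall a, A a -> dot c a <= v) -> dot c x <= v.
Proof.
move=> [k [a [w [Aa w0 w1 ->]]]] Ac; rewrite dot_sumr -[leRHS]mul1r -w1.
by rewrite mulr_suml ler_sum // => i _; rewrite ler_wpM2l ?Ac.
Qed.

Lemma conv_hull_dot_ge A c v x :
  conv_hull A x -> (forall a, A a -> v <= dot c a) -> v <= dot c x.
Proof.
move=> Ax Ac; rewrite -lerN2 -dotNl; apply: (conv_hull_dot_le Ax) => a Aa.
by rewrite dotNl lerN2 Ac.
Qed.

(** A weighted mean reaches the maximum only if all points of nonzero weight
    do. The points of zero weight are replaced by one of the others. *)
Lemma conv_hull_argmax A c v x :
  conv_hull A x -> (forall a, A a -> dot c a <= v) -> dot c x = v ->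
  conv_hull (A `&` [set a | dot c a = v]) x.
Proof.
move=> [k [a [w [Aa w0 w1 ->]]]] Ac; rewrite dot_sumr => xv.
have tight i : w i != 0 -> dot c (a i) = v.
  have /eqP : \sum_i w i * (v - dot c (a i)) = 0.
    under eq_bigr do rewrite mulrBr.
    by rewrite sumrB -mulr_suml w1 mul1r xv subrr.
  rewrite psumr_eq0 => [|j _]; last by rewrite mulr_ge0 // subr_ge0 Ac.
  move=> /allP/(_ i (mem_index_enum i)) /=; rewrite mulf_eq0.
  by case/orP=> [->//|]; rewrite subr_eq0 => /eqP.
have [i0 wi0] : exists i, w i != 0.
  apply/not_existsP => w00; move: w1; rewrite big1 => [|i _].
    by move/eqP; rewrite eq_sym oner_eq0.
  by have /negP := w00 i; rewrite negbK => /eqP.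
exists k, (fun i => if w i == 0 then a i0 else a i), w; split=> // [i|].
  by case: ifPn => [_|wi]; split=> //=; apply: tight.
by apply: eq_bigr => i _; case: eqP => // ->; rewrite !scale0r.
Qed.

Lemma conv_hull_diff A B z :
  conv_hull [set x - y | x in A & y in B] z ->
  exists p q, [/\ conv_hull A p, conv_hull B q & z = p - q].
Proof.
case=> k [a [w [Da w0 w1 ->]]].
have /choice[f fP] (i : 'I_k) :
    exists xy : E * E, [/\ A xy.1, B xy.2 & a i = xy.1 - xy.2].
  by have [x Ax [y By <-]] := Da i; exists (x, y).
exists (\sum_i w i *: (f i).1), (\sum_i w i *: (f i).2); split.
- by exists k, (fun i => (f i).1), w; split=> // i; case: (fP i).
- by exists k, (fun i => (f i).2), w; split=> // i; case: (fP i).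
- rewrite -sumrB; apply: eq_bigr => i _; rewrite -scalerBr.
  by case: (fP i) => _ _ ->.
Qed.

Definition rows s : 'M[R]_(size s, n) := \matrix_(i < size s) s`_i.

Lemma row_rows s i : row i (rows s) = s`_i.
Proof. by rewrite rowK. Qed.

Lemma mulmx_const1 k (w : 'rV[R]_k) :
  w *m const_mx 1 = const_mx (\sum_i w 0 i) :> 'M_1.
Proof.
by apply/rowP => j; rewrite !mxE; apply: eq_bigr => i _; rewrite mxE mulr1.
Qed.

Lemma mem_rows s (i : 'I_(size s)) : [set` s] s`_i.
Proof. by rewrite /= mem_nth. Qed.

(** For a finite set the points of a combination can be fixed to be the listed
    ones, which turns the hull into a linear image of a polyhedron. *)
Lemma hullP b s x : hull b [set` s] x <-> exists w : 'rV_(size s),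
  [/\ b -> forall i, 0 <= w 0 i, \sum_i w 0 i = 1 & x = w *m rows s].
Proof.
split=> [/hull_def[k [a [w [sa w0 w1 ->]]]]|[w [w0 w1 ->]]]; last first.
  apply/hull_def; exists (size s), (fun i => s`_i), (w 0).
  split=> // [i|]; first exact: mem_rows.
  by rewrite mulmx_sum_row; apply: eq_bigr => i _; rewrite row_rows.
have /choice[f fP] (i : 'I_k) : exists j : 'I_(size s), a i = s`_j.
  have ais : (index (a i) s < size s)%N by rewrite index_mem; exact: sa.
  by exists (Ordinal ais); rewrite /= nth_index //; exact: sa.
exists (\sum_i w i *: delta_mx 0 (f i)); split.
- move=> b1 j; rewrite summxE sumr_ge0 // => i _.
  by rewrite !mxE mulr_ge0 ?ler0n // w0.
- have /(congr1 (fun M : 'M_1 => M 0 0)) :=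
    mulmx_const1 (\sum_i w i *: delta_mx 0 (f i)).
  rewrite [RHS]mxE => <-; rewrite mulmx_suml summxE -[RHS]w1.
  by apply: eq_bigr => i _; rewrite -scalemxAl -rowE !mxE mulr1.
- rewrite mulmx_suml; apply: eq_bigr => i _.
  by rewrite -scalemxAl -rowE row_rows fP.
Qed.

Lemma hull_idem b s : hull b (hull b [set` s]) `<=` hull b [set` s].
Proof.
move=> x /hull_def[k [a [w [sa w0 w1 ->]]]]; apply/hullP.
have /choice[f fP] := fun i => (hullP b s (a i)).1 (sa i).
exists (\sum_i w i *: f i); split.
- move=> b1 j; rewrite summxE sumr_ge0 // => i _.
  by rewrite mxE mulr_ge0 ?w0 //; case: (fP i) => /(_ b1).
- under eq_bigr do rewrite summxE.
  rewrite exchange_big -[RHS]w1; apply: eq_bigr => i _ /=.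
  under eq_bigr do rewrite mxE.
  by rewrite -mulr_sumr; case: (fP i) => _ -> _; rewrite mulr1.
- rewrite mulmx_suml; apply: eq_bigr => i _; rewrite -scalemxAl.
  by case: (fP i) => _ _ <-.
Qed.

(** Least norm over the differences of the two hulls. *)
Lemma nearest b U W : U <> [::] -> W <> [::] ->
  exists x y, [/\ hull b [set` U] x, conv_hull [set` W] y &
    forall x' y', hull b [set` U] x' -> conv_hull [set` W] y' ->
      dot (x - y) (x - y) <= dot (x - y) (x' - y')].
Proof.
move=> U0 W0.
have hull0 b' s : s <> [::] -> exists x, hull b' [set` s] x.
  by case: s => // x s _; exists x; apply: hull_incr; rewrite /= inE eqxx.
pose F := col_mx (rows U) (- rows W).
pose A : 'M[R]_(size U + size W, 1 + 1) := block_mx (const_mx 1) 0 0 (const_mx 1).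
pose I := (if b then [seq lshift (size W) i | i <- enum 'I_(size U)] else [::])
            ++ [seq rshift (size U) i | i <- enum 'I_(size W)].
have feas (u : 'rV_(size U)) (w : 'rV_(size W)) :
  feasible A (const_mx 1) I (row_mx u w) <->
  [/\ b -> forall i, 0 <= u 0 i, \sum_i u 0 i = 1, forall i, 0 <= w 0 i
    & \sum_i w 0 i = 1].
  rewrite /feasible mul_row_block !mulmx0 addr0 add0r !mulmx_const1 -row_mx_const.
  split=> [[/eq_row_mx[/(congr1 (fun M : 'M_1 => M 0 0)) +
                       /(congr1 (fun M : 'M_1 => M 0 0))]]|].
    rewrite !mxE => u1 w1 uw; split=> //.
      move=> b1 i; have := uw (lshift _ i); rewrite row_mxEl; apply.
      by rewrite mem_cat b1 map_f // mem_enum.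
    move=> i; have := uw (rshift _ i); rewrite row_mxEr; apply.
    by rewrite mem_cat; apply/orP; right; apply: map_f; rewrite mem_enum.
  case=> u0 -> w0 ->; split=> // i; rewrite mem_cat => /orP[|/mapP[j _ ->]].
    by case: b @I u0 => // _ u0 /mapP[j _ ->]; rewrite row_mxEl u0.
  by rewrite row_mxEr.
have [|uw] := @least_norm_obtuse _ _ _ _ F A (const_mx 1) I.
  have [x /hullP[u [? ? _]]] := hull0 b _ U0.
  have [y /hullP[w [w0 ? _]]] := hull0 true _ W0.
  by exists (row_mx u w); apply/feas; split=> //; exact: w0.
rewrite -[uw]hsubmxK; set u := lsubmx uw; set w := rsubmx uw.
move=> /feas[u0 u1 w0 w1] uwmin.
exists (u *m rows U), (w *m rows W); split.
- by apply/hullP; exists u.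
- by apply/(hullP true); exists w.
- move=> _ _ /hullP[u' [u'0 u'1 ->]] /(hullP true)[w' [w'0 w'1 ->]].
  have := uwmin (row_mx u' w'); rewrite !mul_row_col !mulmxN; apply.
  by apply/feas; split=> //; exact: w'0.
Qed.

(** The last point of a ray from the origin inside a polytope lies on a face
    transverse to the ray. Such a c exists because otherwise, by Farkas' lemma,
    m would be in the cone of directions from l m into the polytope, and one
    could go further. This is strong duality for the linear program of
    maximizing l. *)
Lemma ray_exit s m : m <> 0 -> conv_hull [set` s] 0 ->
  (forall l, conv_hull [set` s] (l *: m) -> l <= 1) ->
  exists l c, [/\ 0 <= l <= 1, conv_hull [set` s] (l *: m), 0 < dot c m &
    forall d, d \in s -> dot c d <= l * dot c m].
Proof.
move=> m0 s0 le1.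
have [l [lge0 sl lmax]] : exists l, [/\ 0 <= l, conv_hull [set` s] (l *: m) &
    forall l', conv_hull [set` s] (l' *: m) -> l' <= l].
  (* The last coordinate is 1 - l, which is nonnegative: maximizing l amounts
     to minimizing its norm. *)
  pose A : 'M[R]_(size s + 1, n + 1) := block_mx (rows s) (const_mx 1) m 0.
  pose F : 'M[R]_(size s + 1, 1) := col_mx 0 1%:M.
  pose I := [seq lshift 1 i | i <- enum 'I_(size s)].
  have feas (w : 'rV_(size s)) l :
    feasible A (row_mx m (const_mx 1)) I (row_mx w (1 - l)%:M) <->
    [/\ forall i, 0 <= w 0 i, \sum_i w 0 i = 1 & l *: m = w *m rows s].
    rewrite /feasible mul_row_block mulmx0 addr0 mulmx_const1 mul_scalar_mx.
    have mE : (w *m rows s + (1 - l) *: m = m) <-> (l *: m = w *m rows s).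
      rewrite scalerBl scale1r; split=> [/(canRL (addrK _))->|<-].
        by rewrite opprB addrCA subrr addr0.
      by rewrite addrCA subrr addr0.
    split=> [[/eq_row_mx[/mE mw /(congr1 (fun M : 'M_1 => M 0 0))]]|].
      rewrite !mxE => w1 w0; split=> // i.
      by have := w0 (lshift _ i); rewrite row_mxEl; apply; apply: map_f; rewrite mem_enum.
    case=> w0 -> /mE ->; split=> // _ /mapP[j _ ->]; by rewrite row_mxEl.
  have feasconv l : conv_hull [set` s] (l *: m) ->
      exists w, feasible A (row_mx m (const_mx 1)) I (row_mx w (1 - l)%:M).
    by move=> /(hullP true)[w [w0 w1 wl]]; exists w; apply/feas; split=> //; exact: w0.
  have convfeas l w : feasible A (row_mx m (const_mx 1)) I (row_mx w (1 - l)%:M) ->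
      conv_hull [set` s] (l *: m).
    by case/feas=> ? ? ?; apply/(hullP true); exists w; split.
  have feas0 := feasconv 0; rewrite scale0r in feas0.
  have [|u uf umin] := @least_norm_obtuse _ _ _ _ F A (row_mx m (const_mx 1)) I.
    by have [w ?] := feas0 s0; exists (row_mx w (1 - 0)%:M).
  pose l : R := 1 - rsubmx u 0 0.
  have uE : u = row_mx (lsubmx u) (1 - l)%:M.
    by rewrite /l opprB addrC subrK -mx11_scalar hsubmxK.
  have lmax l' : conv_hull [set` s] (l' *: m) -> l' <= l.
    move=> sl'; have [w wf] := feasconv _ sl'.
    have := umin _ wf; rewrite uE /F !mul_row_col !mulmx0 !add0r !mulmx1.
    rewrite /dot !big_ord1 !mxE !mulr1n.
    have sl : conv_hull [set` s] (l *: m) by apply: (convfeas _ (lsubmx u)); rewrite -uE.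
    move: (le1 _ sl) (le1 _ sl') => l1 l'1 h.
    rewrite leNgt; apply/negP => ll'.
    have : 0 < (1 - l) * (l' - l) by apply: mulr_gt0; lra.
    lra.
  exists l; split=> //; first by apply: lmax; rewrite scale0r.
  by apply: (convfeas _ (lsubmx u)); rewrite -uE.
pose B := \matrix_(i < size s) (s`_i - l *: m).
have [[t t0 mE]|[c cB cm]] := farkas B m; last first.
  exists l, c; split=> //; first by rewrite lge0 le1.
  move=> d /(nthP 0)[i ilt <-].
  have := cB (Ordinal ilt); rewrite rowK /= dotBr dotZr; lra.
(* m = sum t_i (s_i - l m) would put (1/T + l) m in the hull. *)
exfalso; pose T := \sum_i t 0 i.
have mE' : (1 + T * l) *: m = t *m rows s.
  rewrite scalerDl scale1r {1}mE !mulmx_sum_row /T mulr_suml scaler_suml -big_split.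
  apply: eq_bigr => i _ /=; rewrite !rowK scalerBr scalerA addrC.
  by rewrite addrCA subrr addr0.
have T0 : 0 <= T by rewrite sumr_ge0.
have {T0} T0 : 0 < T.
  rewrite lt_def T0 andbT; apply/eqP => T00; apply: m0.
  have t00 : t = 0.
    apply/rowP => i; rewrite mxE; move/eqP: T00; rewrite psumr_eq0 //.
    by move=> /allP/(_ i (mem_index_enum i)) /= /eqP.
  by rewrite mE t00 mul0mx.
have : conv_hull [set` s] ((T^-1 + l) *: m).
  apply/(hullP true); exists (T^-1 *: t); split.
  - by move=> _ i; rewrite mxE mulr_ge0 // invr_ge0 ltW.
  - by under eq_bigr do rewrite mxE; rewrite -mulr_sumr mulVf // gt_eqF.
  - by rewrite -scalemxAl -mE' scalerA mulrDr mulr1 mulKf // gt_eqF.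
move/lmax; rewrite gerDr leNgt invr_gt0 => /negP; exact.
Qed.
End Hull.

(** * Vertices and faces of a polytope *)

Section Vertices.
Variables (R : realType) (n : nat).
Local Notation E := 'rV[R]_n.
Implicit Types (A B P f : set E) (s V W : seq E) (x y c m t : E).

(** Discard, as long as possible, a point lying in the hull of the others. *)
Lemma polytope_irredundant P : polytope P ->
  exists2 V : seq E, P = conv_hull [set` V] &
    forall t, t \in V -> ~ conv_hull [set` [seq v <- V | v != t]] t.
Proof.
case=> S /finite_seqP[s ->] ->.
have [k] := ubnP (size s); elim: k s => // k IH s sk.
have [[t [ts tconv]]|irr] := pselect (exists t,
    t \in s /\ conv_hull [set` [seq v <- s | v != t]] t); last first.
  by exists s => // t ts tconv; apply: irr; exists t.
set s' := [seq v <- s | v != t] in tconv.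
have [|V VE Virr] := IH s'.
  apply: leq_trans (_ : (_ <= size s)%N) sk.
  rewrite size_filter ltn_neqAle count_size andbT.
  by rewrite -all_count; apply/allPn; exists t => //; rewrite negbK.
exists V => //; rewrite -VE; apply/seteqP; split; last first.
  by apply: (@hull_mono _ _ true) => v; rewrite /= mem_filter => /andP[].
have sub : [set` s] `<=` hull true [set` s'].
  move=> v vs; have [->//|vt] := eqVneq v t.
  by apply: hull_incr; rewrite /= mem_filter vt.
by move=> x /(@hull_mono _ _ true _ _ sub); exact: hull_idem.
Qed.

(** In an irredundant list each t is an exposed point, since the vector from the
    nearest point of the hull of the others to t is maximal at t only.
    Conversely an exposed point, being the only maximizer of a functional, must
    be one of the generators. *)
Lemma polytope_vertices P : polytope P ->
  exists2 V : seq E, vertices P = [set` V] & P = conv_hull [set` V].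
Proof.
move=> /polytope_irredundant[V PE irr]; exists V => //.
apply/seteqP; split=> [v [c [b [Pb vE]]]|t tV].
  have : [set v] v by [].
  rewrite vE => -[Pv /= cv].
  have VP : [set` V] `<=` P by rewrite PE => a; apply: (@hull_incr _ _ true).
  rewrite {1}PE in Pv; have := conv_hull_argmax Pv (fun a Va => Pb a (VP _ Va)) cv.
  move=> /(@hull_nonempty _ _ true)[a [Va ca]].
  have : [set v] a by rewrite vE; split=> //; exact: VP.
  by move=> <-.
set W := [seq v <- V | v != t] in irr *.
have [c cW] : exists c, forall w, w \in W -> dot c w < dot c t.
  have [W0|W0] := pselect (W = [::]); first by exists 0; rewrite W0.
  have [//|x [y [tx Wy obt]]] := @nearest _ _ true [:: t] W _ W0.
  have xt : x = t.
    apply/eqP; rewrite -subr_eq0; apply/eqP/dot_eq0.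
    rewrite dotBr (hull_dot_eq tx (v := dot (x - t) t)) ?subrr // => a.
    by rewrite /= inE => /eqP->.
  exists (x - y) => w wW.
  have xy : x - y <> 0.
    move/eqP; rewrite subr_eq0 => /eqP xy; apply: (irr _ tV).
    by move: Wy; rewrite -xy xt.
  have := obt _ w tx (@hull_incr _ _ true _ _ wW).
  by move/(lt_le_trans (dot_gt0 xy)); rewrite dotBr subr_gt0 xt.
have cV v : v \in V -> dot c v <= dot c t.
  move=> vV; have [->//|vt] := eqVneq v t.
  by apply/ltW/cW; rewrite mem_filter vt.
exists c, (dot c t); split=> [x|].
  by rewrite PE => Px; apply: (conv_hull_dot_le Px).
apply/seteqP; split=> [x ->|x [+ /= cx]].
  by split=> //; rewrite PE; apply: (@hull_incr _ _ true).
rewrite {1}PE => Px; have [k [a [w [at_ w0 w1 ->]]]] := conv_hull_argmax Px cV cx.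
have aE i : a i = t.
  apply/eqP/negPn/negP => ait; have [aV /= cat] := at_ i.
  by have := cW (a i); rewrite cat ltxx mem_filter ait => /(_ aV).
by under eq_bigr do rewrite aE; rewrite -scaler_suml w1 scale1r.
Qed.

Variables (P : set E) (V : seq E).
Hypotheses (vP : vertices P = [set` V]) (PV : P = conv_hull [set` V]).

Let inside f := [seq v <- V | v \in f].
Let outside f := [seq v <- V | v \notin f].

Lemma vertex_in v : v \in V -> P v.
Proof. by move=> vV; rewrite PV; apply: (@hull_incr _ _ true). Qed.

Lemma vertices_outside f : vertices P `\` f = [set` outside f].
Proof.
rewrite vP; apply/seteqP; split=> v /=.
  by case=> vV vf; rewrite mem_filter vV andbT; apply/negP; rewrite inE.
by rewrite mem_filter => /andP[/negP + ->]; rewrite inE.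
Qed.

(** A face is where a functional is maximal, so the weights of its points are
    carried by the maximizing vertices. *)
Lemma face_conv f : face P f -> f = conv_hull [set` inside f].
Proof.
case=> c [b [Pb fE]].
have VP v : [set` V] v -> dot c v <= b by move=> /vertex_in/Pb.
apply/seteqP; split=> x.
  rewrite {1}fE => -[+ /= cx]; rewrite {1}PV => Px.
  have := conv_hull_argmax Px VP cx; apply: (@hull_mono _ _ true) => v [vV /= cv].
  rewrite /= mem_filter; apply/andP; split=> //.
  by rewrite inE fE; split=> //; exact: vertex_in.
move=> fx; rewrite fE; split.
  rewrite PV; apply: (@hull_mono _ _ true) fx => v /=.
  by rewrite mem_filter => /andP[].
apply: (@hull_dot_eq _ _ true _ _ _ _ fx) => v /=.
by rewrite mem_filter => /andP[/set_mem + _]; rewrite {1}fE => -[].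
Qed.

Lemma hull_face b f : face P f -> hull b f = hull b [set` inside f].
Proof.
move=> fP; apply/seteqP; split=> x.
  rewrite {1}(face_conv fP) => /(hull_mono (@conv_sub_hull _ _ b _)).
  exact: hull_idem.
by apply: hull_mono => v /=; rewrite mem_filter => /andP[/set_mem].
Qed.

Lemma conv_hull_face f : face P f -> hull true f = f.
Proof. by move=> fP; rewrite (hull_face true fP) [RHS]face_conv. Qed.

Lemma proper_face_inside f : proper_face P f -> inside f <> [::].
Proof.
case=> fP f0 _ i0; have /eqP/set0P[x] : f <> set0 by [].
rewrite (face_conv fP) => /(@hull_nonempty _ _ true)[v].
by rewrite /= i0.
Qed.

Lemma proper_face_outside f : proper_face P f -> outside f <> [::].
Proof.
case=> fP _ f1 o0; apply: f1; rewrite [LHS]face_conv // [RHS]PV.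
suff -> : inside f = V by []; apply/all_filterP/allP => v vV.
apply/negPn/negP => vf; have : v \in outside f by rewrite mem_filter vf.
by rewrite o0.
Qed.

Lemma minimum_eq (S : set R) r : S r -> lbound S r -> minimum S = r.
Proof.
move=> Sr lr; apply: xget_unique => // r' [Sr' lr'].
by apply/eqP; rewrite eq_le lr' // lr.
Qed.

(** The obtuse angle condition is sufficient for being nearest. *)
Lemma dist_obtuse A B x y : A x -> B y ->
  (forall x' y', A x' -> B y' -> dot (x - y) (x - y) <= dot (x - y) (x' - y')) ->
  dist A B = enorm (x - y) /\
  forall x' y', A x' -> B y' -> enorm (x - y) <= enorm (x' - y').
Proof.
move=> Ax By obt.
have le x' y' : A x' -> B y' -> enorm (x - y) <= enorm (x' - y').
  move=> Ax' By'; apply: enorm_le; have := obt _ _ Ax' By'.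
  move: (x - y) (x' - y') => m z mz; have := dot_ge0 (z - m).
  rewrite dotBl !dotBr (dotC z m); lra.
split=> //; apply: minimum_eq; first by exists x => //; exists y.
by move=> _ [x' Ax' [y' By' <-]]; exact: le.
Qed.

Lemma dist_attained b f : proper_face P f -> exists x y,
  [/\ hull b f x, conv_hull (vertices P `\` f) y,
      forall x' y', hull b f x' -> conv_hull (vertices P `\` f) y' ->
        dot (x - y) (x - y) <= dot (x - y) (x' - y'),
      dist (hull b f) (conv_hull (vertices P `\` f)) = enorm (x - y)
    & forall x' y', hull b f x' -> conv_hull (vertices P `\` f) y' ->
        enorm (x - y) <= enorm (x' - y')].
Proof.
move=> pf; have [fP _ _] := pf.
rewrite (hull_face b fP) vertices_outside.
have [x [y [fx oy obt]]] :=
  nearest b (proper_face_inside pf) (proper_face_outside pf).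
by exists x, y; have [-> le] := dist_obtuse fx oy obt.
Qed.

(** The heart of the proof: the face g where a ray, in the direction joining the
    nearest points of aff(f) and conv(V \ f), leaves the polytope of differences
    between P and the layer V' of vertices reaching from y up to f. *)
Lemma closer_proper_face f : proper_face P f -> exists2 g, proper_face P g &
  dist g (conv_hull (vertices P `\` g)) <=
  dist (aff_hull f) (conv_hull (vertices P `\` f)).
Proof.
move=> pf; have [fP f0 _] := pf; have [c0 [b0 [Pb0 fE]]] := fP.
have [x [y [fx oy obt ->]]] := dist_attained false pf.
rewrite /= in fx obt *; move=> _.
set m := x - y in obt *.
have m0 : m <> 0.
  move=> /eqP; rewrite subr_eq0 => /eqP xy.
  have c0x : dot c0 x = b0.
    by apply: (@hull_dot_eq _ _ false _ _ _ _ fx) => a; rewrite {1}fE => -[].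
  have oPb v : (vertices P `\` f) v -> dot c0 v <= b0.
    by rewrite vP => -[/vertex_in/Pb0].
  rewrite xy in c0x; have := conv_hull_argmax oy oPb c0x.
  move=> /(@hull_nonempty _ _ true)[v [[+ vf] /= cv]]; rewrite vP => vV.
  by apply: vf; rewrite fE; split=> //; exact: vertex_in.
have D0 := dot_gt0 m0; set D := dot m m in D0 obt.
have Dxy : D = dot m x - dot m y by rewrite -dotBr.
have mf v : f v -> dot m v = dot m x.
  move=> fv; apply/eqP; rewrite eq_le; apply/andP; split; last first.
    have := obt v y (@hull_incr _ _ false _ _ fv) oy; rewrite dotBr; lra.
  (* The reflection of v through x gives the opposite inequality: it stays in
     the affine hull, though not in the face. *)
  have fr : hull false f (x + (x - v)).
    rewrite (hull_face false fP); apply: hull_idem; apply/hull_def.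
    exists 2%N, (fun i : 'I_2 => if i == ord0 then x else v).
    exists (fun i : 'I_2 => if i == ord0 then 2 else -1).
    split=> // [i||].
    - rewrite -(hull_face false fP); case: ifP => // _; exact: hull_incr.
    - rewrite !big_ord_recl big_ord0 /=; lra.
    - rewrite !big_ord_recl big_ord0 /= addr0 scaleN1r scaler_nat mulr2n.
      by rewrite addrA.
  have := obt _ y fr oy; rewrite dotBr dotDr dotBr; lra.
have mo v : v \in V -> v \notin f -> dot m v <= dot m y.
  move=> vV vf; have ov : (vertices P `\` f) v.
    by rewrite vertices_outside /= mem_filter vf.
  have := obt x v fx (@hull_incr _ _ true _ _ ov); rewrite dotBr; lra.
have mV v : v \in V -> dot m v <= dot m x.
  move=> vV; have [|vf] := boolP (v \in f); first by move=> /set_mem/mf->.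
  have := mo _ vV vf; lra.
pose V' := [seq v <- V | dot m y <= dot m v].
have V'V : [set` V'] `<=` [set` V] by move=> v; rewrite /= mem_filter => /andP[].
have V'x : aff_hull [set` V'] x.
  move: fx; rewrite [aff_hull f](hull_face false fP).
  apply: (@hull_mono _ _ false) => v; rewrite /= !mem_filter.
  move=> /andP[/set_mem vf ->]; rewrite andbT (mf _ vf); lra.
have V'y : conv_hull [set` V'] y.
  have om v : (vertices P `\` f) v -> dot m v <= dot m y.
    by rewrite vertices_outside /= mem_filter => /andP[vf vV]; exact: mo.
  have := conv_hull_argmax oy om erefl; apply: (@hull_mono _ _ true) => v [+ /= mv].
  by rewrite vertices_outside /= !mem_filter mv lexx => /andP[_ ->].
pose s := [seq v - v' | v <- V, v' <- V'].
have sE : [set` s] = [set v - v' | v in [set` V] & v' in [set` V']].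
  apply/seteqP; split=> d /=.
    by move=> /allpairsP[[v v'] /= [vV v'V' ->]]; exists v => //; exists v'.
  by case=> v vV [v' v'V' <-]; apply/allpairsP; exists (v, v').
have [||l [c [/andP[l0 l1] sl cm cs]]] := @ray_exit _ _ s m m0.
- have [v V'v] := @hull_nonempty _ _ true _ _ V'y.
  apply: (@hull_incr _ _ true); rewrite sE; exists v; first exact: V'V.
  by exists v => //; rewrite subrr.
- move=> l sl; rewrite -(ler_pM2r D0) mul1r -dotZr; apply: (conv_hull_dot_le sl).
  rewrite sE => _ [v /mV + [v' + <-]]; rewrite /= mem_filter => + /andP[+ _].
  rewrite dotBr; lra.
have := sl; rewrite {1}sE => /conv_hull_diff[p [q [Vp V'q pq]]].
have cpq : dot c p - dot c q = l * dot c m by rewrite -dotBr -pq dotZr.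
have {}cs v v' : v \in V -> v' \in V' -> dot c v - dot c v' <= l * dot c m.
  by move=> vV v'V'; rewrite -dotBr; apply: cs; apply/allpairsP; exists (v, v').
have cV v : v \in V -> dot c v <= dot c p.
  move=> vV; rewrite -(subrK (dot c q) (dot c p)) cpq -lerBlDl.
  apply: (conv_hull_dot_ge V'q) => v' v'V'; have := cs _ _ vV v'V'; lra.
have cV' v' : v' \in V' -> dot c q <= dot c v'.
  move=> v'V'; suff : dot c p <= dot c v' + l * dot c m by lra.
  by apply: (conv_hull_dot_le Vp) => v vV; have := cs _ _ vV v'V'; lra.
(* If l = 0, then c is constant on V', hence at x and y, contradicting cm. *)
have cqp : dot c q < dot c p.
  rewrite lt_neqAle -subr_ge0 cpq mulr_ge0 ?(ltW cm) // andbT.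
  apply/eqP => qp.
  have cst v' : [set` V'] v' -> dot c v' = dot c p.
    move=> v'V'; apply/eqP; rewrite eq_le cV ?(V'V _ v'V') //= -qp; exact: cV'.
  move: cm; rewrite dotBr (@hull_dot_eq _ _ false _ _ _ _ V'x cst).
  by rewrite (@hull_dot_eq _ _ true _ _ _ _ V'y cst) subrr ltxx.
pose g := P `&` [set z | dot c z = dot c p].
have Pp : P p by rewrite PV.
have gp : g p by split.
have gq : conv_hull (vertices P `\` g) q.
  have cN v : [set` V'] v -> dot (- c) v <= - dot c q.
    by move=> /cV'; rewrite dotNl lerN2.
  have := conv_hull_argmax V'q cN (dotNl c q); apply: (@hull_mono _ _ true).
  move=> v [vV' /=]; rewrite dotNl => /oppr_inj cv.
  split; first by rewrite vP; exact: V'V.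
  by case=> _ /= cvp; move: cqp; rewrite -cv cvp ltxx.
have pg : proper_face P g.
  split.
  - exists c, (dot c p); split=> // z.
    by rewrite {1}PV => /conv_hull_dot_le; apply.
  - by move=> g0; move: gp; rewrite g0.
  - have [v [+ vg]] := @hull_nonempty _ _ true _ _ gq.
    by rewrite vP => /vertex_in + gP; rewrite -gP.
exists g => //.
have [u [w [gu ow _ + le]]] := dist_attained true pg.
have gE : hull true g = g by apply: conv_hull_face; case: pg.
rewrite gE in le *; move=> ->.
apply: (le_trans (le _ _ gp gq)); apply: enorm_le.
rewrite -pq dotZl dotZr mulrA -[leRHS]mul1r ler_pM2r //.
by rewrite mulr_ile1.
Qed.

(** A face is determined by the vertices that it contains. *)
Lemma finite_proper_faces : finite_set (proper_face P).
Proof.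
apply: (@sub_finite_set _ _
  [set conv_hull [set` mask t V] | t in [set: (size V).-tuple bool]]).
  move=> f [fP _ _].
  exists (map_tuple (fun v => v \in f) (in_tuple V)) => //=.
  by rewrite -filter_mask -face_conv.
exact/finite_image/finite_finset.
Qed.

Lemma minimum_attained (F : set E -> R) : (exists f, proper_face P f) ->
  exists2 f, proper_face P f & minimum [set F f | f in proper_face P] = F f /\
    forall g, proper_face P g -> F f <= F g.
Proof.
move=> [f0 pf0].
have /finite_seqP[s sE] := finite_image F finite_proper_faces.
have [r sr rmin] : exists2 r, r \in s & forall r', r' \in s -> r <= r'.
  have : F f0 \in s by have : [set` s] (F f0) by rewrite -sE; exists f0.
  elim: s (F f0) {sE} => // r s IH r0 _.
  case: s IH => [_|r1 s IH].
    by exists r; rewrite ?inE // => r'; rewrite inE => /eqP->.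
  have [|r2 r2s r2min] := IH r1; first by rewrite inE eqxx.
  have [rr2|r2r] := leP r r2.
    exists r; first by rewrite inE eqxx.
    by move=> r'; rewrite inE => /orP[/eqP->//|/r2min]; exact: le_trans.
  exists r2; first by rewrite inE r2s orbT.
  by move=> r'; rewrite inE => /orP[/eqP->|/r2min//]; exact: ltW.
have : [set` s] r by [].
rewrite -sE => -[f pf Ff]; rewrite -Ff in sr rmin; exists f => //.
have le g : proper_face P g -> F f <= F g.
  move=> pg; apply: rmin; have : [set` s] (F g) by rewrite -sE; exists g.
  by [].
split=> //; apply: minimum_eq; first by exists f.
by move=> _ [g pg <-]; exact: le.
Qed.

End Vertices.

Unset Implicit Arguments.

Theorem corollary4p4 (R : realType) (n : nat) (P : set 'rV[R]_n)
  (P_polytope : polytope P)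
  (two_vertices : exists v w : 'rV[R]_n,
      [/\ vertices P v, vertices P w & v <> w]) :
  pyramidal_width P = affine_pyramidal_width P.
Proof.
have [V vP PV] := polytope_vertices P_polytope.
have pf0 : exists f, proper_face P f.
  have [v [w [Pv Pw vw]]] := two_vertices; exists [set v]; split=> //.
    by move=> v0; have : [set v] v by []; rewrite v0.
  move=> vE; apply: vw; have : P w; last by rewrite -vE.
  by apply: (vertex_in PV); move: Pw; rewrite vP.
have [f pf [fE fmin]] := minimum_attained PV
  (fun f => dist f (conv_hull (vertices P `\` f))) pf0.
have [g pg [gE gmin]] := minimum_attained PV
  (fun f => dist (aff_hull f) (conv_hull (vertices P `\` f))) pf0.
rewrite [LHS]fE [RHS]gE; apply/eqP; rewrite eq_le; apply/andP; split.
  by have [h /fmin le1 le2] := closer_proper_face vP PV pg; apply: le_trans le2.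
apply: le_trans (gmin _ pf) _.
have [x [y [fx oy _ + _]]] := dist_attained vP PV true pf.
have -> : hull true f = f by apply: (conv_hull_face PV); case: pf.
move=> ->.
have [u [w [_ _ _ -> le]]] := dist_attained vP PV false pf.
by apply: le => //; apply: conv_sub_hull.
Qed.
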